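(* Let $f_n, f\in\mathcal T'$ and $g_n,g\in d\mathbb G$ ($n=1,2,\dots$). If $f_n\to f$ in $\mathcal T'$ and $g_n\to g$ in $d\mathbb G$, then $g_nf_n\to gf$ in $\mathcal T'$.
   Context: Let $I=(a,b)\subset\mathbf R$ be a fixed open interval (possibly unbounded; then one-sided limits at $a$ or $b$ are limits at $\mp\infty$) and $J=[-\frac12,\frac12]$. Regulated functions: $\mathbb G(J)$ is the algebra of functions $h:J\to\mathbf R$ having finite one-sided limits $h(s\pm)$ at all interior points of $J$, and $h(-\frac12+)$, $h(\frac12-)$; functions with the same one-sided limits are identified. Sup and absolute-value bounds of elements of $\mathbb G(J)$ are computed via one-sided limits, e.g. $\sup_{s\in J}|h(s)|$ means the supremum of the absolute values of all the one-sided limits of $h$. Dynamic functions: a dynamic function is a map $f$ assigning to each $t\in I$ a function $f(t)(\cdot)$ on $J$ (its dynamic value at $t$). Sums, products and scalar multiples are defined pointwise in $t$ and $s$. If $f(t)(\cdot)$ is constant, $f$ is said to have an ordinary value at $t$, and this constant is denoted $f(t)\in\mathbf R$. For $M\subset I$, $\sup_M|f|=\sup_{t\in M}\sup_{s\in J}|f(t)(s)|$. If $f$ is bounded in a right neighbourhood of $\tau$, then $f(\tau+)=c\in\mathbf R$ means: for every $\varepsilon>0$ there is $\eta>0$ with $\sup_{(\tau,\tau+\eta)}|f-c|<\varepsilon$; $f(\tau-)$, $f(a+)$, $f(b-)$ are defined analogously. $d\mathbb G$ is the algebra of dynamic functions $f$ with $f(t)(\cdot)\in\mathbb G(J)$ for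 all $t\in I$ such that $f(a+)$, $f(b-)$, $f(\tau+)$, $f(\tau-)$ exist for all $\tau\in I$, with norm $\|f\|_{d\mathbb G}=\sup_I|f|$. Convergence in $d\mathbb G$ is convergence in this norm. Test functions and distributions: $\operatorname{supp} f$ is the closure in $I$ of $\{t\in I: f(t)(\cdot)\text{ is not ordinary or } f(t)\neq0\}$. $\mathcal T$ is the space of $\varphi\in d\mathbb G$ with compact support in $I$; $\varphi_n\to\varphi$ in $\mathcal T$ means $\varphi_n\to\varphi$ in $d\mathbb G$ and there is a closed interval $[c,d]\subset I$ with $\operatorname{supp}\varphi_n\subset[c,d]$ for all $n$. $\mathcal T'$ is the space of linear functionals $\mathcal T\to\mathbf R$ continuous with respect to this convergence; the value of $f$ on $\varphi$ is written $(f,\varphi)$. Convergence $f_n\to f$ in $\mathcal T'$ means $(f_n,\varphi)\to(f,\varphi)$ for every $\varphi\in\mathcal T$. Multiplication: for $g\in d\mathbb G$ and $f\in\mathcal T'$, the product $gf\in\mathcal T'$ is defined by $(gf,\varphi)=(f,g\varphi)$ for $\varphi\in\mathcal T$ (note $g\varphi\in\mathcal T$). *)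

(* Defs.v *)
From HB Require Import structures.
From mathcomp Require Import all_boot all_order all_algebra.
From mathcomp Require Import generic_quotient.
From mathcomp Require Import all_classical all_reals all_analysis.

Set Implicit Arguments.
Unset Strict Implicit.
Unset Printing Implicit Defensive.

Import Order.TTheory GRing.Theory Num.Theory.
Import numFieldNormedType.Exports.

Local Open Scope classical_set_scope.
Local Open Scope ring_scope.

Section Regulated.
Context {R : realType}.
Implicit Types (h k : R -> R) (F : set_system R).

(* The one-sided limits taken for functions on J = [-1/2, 1/2].              *)
Definition J_sides : set (set_system R) :=
  [set F | (exists2 s : R, - 2^-1 <= s < 2^-1 & F = s^'+) \/
           (exists2 s : R, - 2^-1 < s <= 2^-1 & F = s^'-)].

(* A function on J is represented by a function on R: each filter in         *)
(* J_sides contains the interior of J, so values outside J are irrelevant.   *)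
Definition regulated h : Prop := forall F, J_sides F -> cvg (h @ F).

Definition same_limits h k : Prop :=
  forall F, J_sides F -> lim (h @ F) = lim (k @ F).

Lemma J_sides_proper F : J_sides F -> ProperFilter F.
Proof. by case=> -[s _ ->]; exact: _. Qed.

Lemma regulated_cst (c : R) : regulated (fun=> c).
Proof.
move=> F /J_sides_proper FF; apply/cvg_ex; exists c; exact: cvg_cst.
Qed.

Lemma regulatedD h k : regulated h -> regulated k -> regulated (h \+ k).
Proof.
move=> rh rk F JF; have FF := J_sides_proper JF.
by apply: is_cvgD; [exact: rh|exact: rk].
Qed.

Lemma regulatedM h k : regulated h -> regulated k -> regulated (h \* k).
Proof.
move=> rh rk F JF; have FF := J_sides_proper JF.
by apply: is_cvgM; [exact: rh|exact: rk].
Qed.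

End Regulated.

Record regfun (R : realType) : Type := Regfun {
  regfun_val :> R -> R ;
  regfunP : regulated regfun_val }.
Arguments regfunP {R} _ {F}.

HB.instance Definition _ (R : realType) := gen_eqMixin (regfun R).
HB.instance Definition _ (R : realType) := gen_choiceMixin (regfun R).

Section GJ.
Context (R : realType).
Local Open Scope quotient_scope.

Definition reg_eq (h k : regfun R) : bool := `[< same_limits h k >].

Let reg_eq_refl : reflexive reg_eq.
Proof. by move=> h; apply/asboolP. Qed.

Let reg_eq_sym : symmetric reg_eq.
Proof.
by move=> h k; apply/idP/idP => /asboolP hk; apply/asboolP => F JF; rewrite hk.
Qed.

Let reg_eq_trans : transitive reg_eq.
Proof.
move=> k h l /asboolP hk /asboolP kl; apply/asboolP => F JF.
by rewrite hk// kl.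
Qed.

Canonical reg_eq_canonical :=
  EquivRel reg_eq reg_eq_refl reg_eq_sym reg_eq_trans.

(* The algebra G(J): regulated functions modulo equality of all one-sided    *)
(* limits.                                                                   *)
Definition GJ : Type := {eq_quot reg_eq}.
HB.instance Definition _ := Choice.on GJ.
HB.instance Definition _ := EqQuotient.on GJ.

Implicit Types (x y : GJ) (c : R) (F : set_system R).

(* The one-sided limit of a class along F in J_sides.                        *)
Definition glim (x : GJ) (F : set_system R) : R := lim (repr x @ F).

Definition gcst (c : R) : GJ := \pi_GJ (Regfun (@regulated_cst R c)).
Definition gadd (x y : GJ) : GJ :=
  \pi_GJ (Regfun (regulatedD (@regfunP R (repr x)) (@regfunP R (repr y)))).
Definition gmul (x y : GJ) : GJ :=
  \pi_GJ (Regfun (regulatedM (@regfunP R (repr x)) (@regfunP R (repr y)))).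
Definition gscale (c : R) (x : GJ) : GJ := gmul (gcst c) x.
Definition gopp (x : GJ) : GJ := gscale (-1) x.

Definition gsup (x : GJ) : \bar R :=
  ereal_sup [set `|glim x F|%:E | F in J_sides].

Lemma glim_pi (h : regfun R) F : J_sides F -> glim (\pi_GJ h) F = lim (h @ F).
Proof.
move=> JF; rewrite /glim; case: (piP GJ h) => k /eqP.
by rewrite eqmodE => /asboolP ->.
Qed.

Lemma glim_cvg x F : J_sides F -> repr x @ F --> glim x F.
Proof. by move=> JF; exact: (regfunP (repr x) JF). Qed.

Lemma glim_inj x y : (forall F, J_sides F -> glim x F = glim y F) -> x = y.
Proof.
move=> xy; rewrite -[x]reprK -[y]reprK; apply/eqmodP; apply/asboolP => F.
exact: xy.
Qed.

Lemma glim_cst c F : J_sides F -> glim (gcst c) F = c.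
Proof.
move=> JF; have FF := J_sides_proper JF.
rewrite glim_pi//=; apply: (@cvg_lim _ _ _ (F : set_system _)) => //.
exact: cvg_cst.
Qed.

Lemma glim_add x y F : J_sides F -> glim (gadd x y) F = glim x F + glim y F.
Proof.
move=> JF; have FF := J_sides_proper JF.
rewrite glim_pi//=; apply/cvg_lim => //.
by apply: cvgD; exact: glim_cvg.
Qed.

Lemma glim_mul x y F : J_sides F -> glim (gmul x y) F = glim x F * glim y F.
Proof.
move=> JF; have FF := J_sides_proper JF.
rewrite glim_pi//=; apply/cvg_lim => //.
by apply: cvgM; exact: glim_cvg.
Qed.

Lemma glim_scale c x F : J_sides F -> glim (gscale c x) F = c * glim x F.
Proof. by move=> JF; rewrite glim_mul// glim_cst. Qed.

Lemma glim_opp x F : J_sides F -> glim (gopp x) F = - glim x F.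
Proof. by move=> JF; rewrite glim_scale// mulN1r. Qed.

Let gaddA : associative gadd.
Proof. by move=> x y z; apply: glim_inj => F JF; rewrite !glim_add// addrA. Qed.
Let gaddC : commutative gadd.
Proof. by move=> x y; apply: glim_inj => F JF; rewrite !glim_add// addrC. Qed.
Let gadd0 : left_id (gcst 0) gadd.
Proof.
by move=> x; apply: glim_inj => F JF; rewrite !glim_add// glim_cst// add0r.
Qed.
Let gaddN : left_inverse (gcst 0) gopp gadd.
Proof.
move=> x; apply: glim_inj => F JF.
by rewrite !glim_add// glim_opp// glim_cst// addNr.
Qed.

HB.instance Definition _ := GRing.isZmodule.Build GJ gaddA gaddC gadd0 gaddN.

Let gmulA : associative gmul.
Proof. by move=> x y z; apply: glim_inj => F JF; rewrite !glim_mul// mulrA. Qed.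
Let gmulC : commutative gmul.
Proof. by move=> x y; apply: glim_inj => F JF; rewrite !glim_mul// mulrC. Qed.
Let gmul1 : left_id (gcst 1) gmul.
Proof.
by move=> x; apply: glim_inj => F JF; rewrite !glim_mul// glim_cst// mul1r.
Qed.
Let gmulD : left_distributive gmul gadd.
Proof.
move=> x y z; apply: glim_inj => F JF.
by rewrite !(glim_mul, glim_add)// mulrDl.
Qed.

HB.instance Definition _ :=
  GRing.Zmodule_isComPzRing.Build GJ gmulA gmulC gmul1 gmulD.

Let gscaleA c d x : gscale c (gscale d x) = gscale (c * d) x.
Proof. by apply: glim_inj => F JF; rewrite !glim_scale// mulrA. Qed.
Let gscale1 : left_id 1 gscale.
Proof. by move=> x; apply: glim_inj => F JF; rewrite !glim_scale// mul1r. Qed.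
Let gscaleDr : right_distributive gscale +%R.
Proof.
by move=> c x y; apply: glim_inj => F JF;
  rewrite !(glim_scale, glim_add)// mulrDr.
Qed.
Let gscaleDl x : {morph gscale^~ x : c d / c + d}.
Proof.
by move=> c d; apply: glim_inj => F JF;
  rewrite !(glim_scale, glim_add)// mulrDl.
Qed.

HB.instance Definition _ :=
  GRing.Zmodule_isLmodule.Build R GJ gscaleA gscale1 gscaleDr gscaleDl.

Lemma glim0 F : J_sides F -> glim 0 F = 0. Proof. exact: glim_cst. Qed.
Lemma glim1 F : J_sides F -> glim 1 F = 1. Proof. exact: glim_cst. Qed.
Lemma glimD x y F : J_sides F -> glim (x + y) F = glim x F + glim y F.
Proof. exact: glim_add. Qed.
Lemma glimN x F : J_sides F -> glim (- x) F = - glim x F.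
Proof. exact: glim_opp. Qed.
Lemma glimB x y F : J_sides F -> glim (x - y) F = glim x F - glim y F.
Proof. by move=> JF; rewrite glimD// glimN. Qed.
Lemma glimM x y F : J_sides F -> glim (x * y) F = glim x F * glim y F.
Proof. exact: glim_mul. Qed.
Lemma glimZ c x F : J_sides F -> glim (c *: x) F = c * glim x F.
Proof. exact: glim_scale. Qed.

Lemma scalerAr_GJ c x y : x * (c *: y) = c *: (x * y).
Proof.
by apply: glim_inj => F JF; rewrite !(glimM, glimZ)// mulrCA.
Qed.

End GJ.

Section Dynamic.
Context {R : realType}.

(* As a type, this set carries the subspace topology of R.                   *)
Definition oitv (a b : \bar R) : set R := [set t : R | (a < t%:E < b)%E].

Context {a b : \bar R}.
Notation I := (oitv a b).

Notation dyn := (I -> GJ R).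
Implicit Types (f g : dyn) (c : R) (e : \bar R).

Definition dcst c : dyn := fun=> gcst c.

Definition dsup (M : set I) f : \bar R := ereal_sup [set gsup (f t) | t in M].

(* f(e+) = c and f(e-) = c. Taking e in \bar R treats e = a and e = b, finite *)
(* or infinite, uniformly; for finite e, y stands for e + eta, e - eta.      *)
(* Boundedness of f near e is a consequence.                                 *)
Definition rlim f e c : Prop := forall eps : R, 0 < eps ->
  exists2 y : R, (e < y%:E)%E &
    (dsup [set t : I | (e < (\val t)%:E < y%:E)%E] (f - dcst c)%R < eps%:E)%E.

Definition llim f e c : Prop := forall eps : R, 0 < eps ->
  exists2 y : R, (y%:E < e)%E &
    (dsup [set t : I | (y%:E < (\val t)%:E < e)%E] (f - dcst c)%R < eps%:E)%E.

Definition in_dG f : Prop :=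
  (forall e, (a <= e < b)%E -> exists c, rlim f e c) /\
  (forall e, (a < e <= b)%E -> exists c, llim f e c).

Definition dG_pred : {pred dyn} := [pred f : dyn | `[< in_dG f >]].

End Dynamic.
Arguments oitv {R} a b.

(* The algebraic operations are the pointwise ones of function spaces.       *)
Notation dyn a b := (oitv a b -> GJ _).

Section DynamicTheory.
Context {R : realType} {a b : \bar R}.
Notation I := (oitv a b).
Notation dyn := (I -> GJ R).
Implicit Types (f g : dyn) (c : R) (e : \bar R).

Lemma J_sides0 : J_sides ((0 : R)^'+).
Proof.
by left; exists 0 => //; rewrite oppr_le0 invr_ge0 invr_gt0 ler0n ltr0n.
Qed.

Lemma gsup_le (x : GJ R) (k : \bar R) :
  (gsup x <= k)%E <-> forall F, J_sides F -> (`|glim x F|%:E <= k)%E.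
Proof.
split=> [xk F JF|xk].
  by apply: le_trans xk; apply: ereal_sup_ubound; exists F.
by apply: ge_ereal_sup => _ [F JF <-]; exact: xk.
Qed.

Lemma gsup_ge0 (x : GJ R) : (0 <= gsup x)%E.
Proof.
have /gsup_le/(_ _ J_sides0) := lexx (gsup x).
by apply: le_trans; rewrite lee_fin.
Qed.

Lemma dsup_le (M : set I) f (k : \bar R) :
  (dsup M f <= k)%E <->
  forall t, M t -> forall F, J_sides F -> (`|glim (f t) F|%:E <= k)%E.
Proof.
split=> [fk t Mt|fk].
  by apply/gsup_le; apply: le_trans fk; apply: ereal_sup_ubound; exists t.
by apply: ge_ereal_sup => _ [t Mt <-]; apply/gsup_le; exact: fk.
Qed.

Let blim (B : set (set I)) f c : Prop := forall eps : R, 0 < eps ->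
  exists2 M : set I, B M & (dsup M (f - dcst c)%R < eps%:E)%E.

Let bfilter (B : set (set I)) : set_system (I * set_system R) :=
  [set A | exists2 M : set I, B M & forall t F, M t -> J_sides F -> A (t, F)].

Let rbase e : set (set I) := [set M | exists2 y : R, (e < y%:E)%E &
  M = [set t : I | (e < (\val t)%:E < y%:E)%E]].
Let lbase e : set (set I) := [set M | exists2 y : R, (y%:E < e)%E &
  M = [set t : I | (y%:E < (\val t)%:E < e)%E]].

Let blim_r f e c : rlim f e c <-> blim (rbase e) f c.
Proof.
split=> H eps /H [].
  move=> y ey fy.
  by exists [set t : I | (e < (\val t)%:E < y%:E)%E] => //; exists y.
by move=> _ [y ey ->] fy; exists y.
Qed.

Let blim_l f e c : llim f e c <-> blim (lbase e) f c.
Proof.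
split=> H eps /H [].
  move=> y ey fy.
  by exists [set t : I | (y%:E < (\val t)%:E < e)%E] => //; exists y.
by move=> _ [y ey ->] fy; exists y.
Qed.

Let directed (B : set (set I)) := B !=set0 /\
  forall M N, B M -> B N -> exists2 K, B K & K `<=` M `&` N.

Let rbase_directed e : (e < +oo)%E -> directed (rbase e).
Proof.
move=> eoo; split.
  case: e eoo => [r|//|] _; last first.
    by exists [set t | (-oo < (\val t)%:E < 0%:E)%E], 0 => //; exact: ltNyr.
  exists [set t | (r%:E < (\val t)%:E < (r + 1)%:E)%E], (r + 1) => //.
  by rewrite lte_fin ltrDl.
move=> _ _ [y ey ->] [z ez ->].
exists [set t | (e < (\val t)%:E < (Num.min y z)%:E)%E].
  by exists (Num.min y z) => //; rewrite EFin_min lt_min ey.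
by move=> t /= /andP[et]; rewrite EFin_min lt_min => /andP[-> ->]; rewrite et.
Qed.

Let lbase_directed e : (-oo < e)%E -> directed (lbase e).
Proof.
move=> eoo; split.
  case: e eoo => [r|_|//]; last first.
    by exists [set t | (0%:E < (\val t)%:E < +oo)%E], 0 => //; exact: ltry.
  exists [set t | ((r - 1)%:E < (\val t)%:E < r%:E)%E], (r - 1) => //.
  by rewrite lte_fin gtrBl.
move=> _ _ [y ey ->] [z ez ->].
exists [set t | ((Num.max y z)%:E < (\val t)%:E < e)%E].
  by exists (Num.max y z) => //; rewrite EFin_max gt_max ey.
by move=> t /= /andP[]; rewrite EFin_max gt_max => /andP[-> ->] ->.
Qed.

Let bfilter_filter B : directed B -> Filter (bfilter B).
Proof.
move=> [[M0 BM0] BI]; split.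
- by exists M0.
- move=> P Q [M BM MP] [N BN NQ]; have [K BK KMN] := BI _ _ BM BN.
  exists K => // t F /KMN[Mt Nt] JF; split; [exact: MP|exact: NQ].
- by move=> P Q PQ [M BM MP]; exists M => // t F Mt JF; exact/PQ/MP.
Qed.

Let blimP B f c : directed B ->
  blim B f c <-> (fun p => glim (f p.1) p.2) @ bfilter B --> c.
Proof.
move=> /bfilter_filter BF; split.
  move=> H; apply/cvgrPdist_le => /= eps /H [M BM fM]; exists M => // t F Mt JF.
  move: (ltW fM) => /dsup_le/(_ t Mt F JF).
  rewrite [(f - dcst c)%R t]/(f t - gcst c).
  by rewrite glimB// glim_cst// lee_fin distrC.
move=> /cvgrPdist_le /= H eps eps0.
have /H [M BM fM] : 0 < eps / 2 by rewrite divr_gt0.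
exists M => //; apply: (@le_lt_trans _ _ (eps / 2)%:E); last first.
  by rewrite lte_fin ltr_pdivrMr// ltr_pMr// ltr1n.
apply/dsup_le => t Mt F JF; rewrite [(f - dcst c)%R t]/(f t - gcst c).
rewrite glimB// glim_cst// lee_fin distrC; exact: (fM t F).
Qed.

Let bcongr B (u v : I * set_system R -> R) c : directed B ->
  (forall t F, J_sides F -> u (t, F) = v (t, F)) ->
  u @ bfilter B --> c -> v @ bfilter B --> c.
Proof.
move=> dB uv; have BF := bfilter_filter dB.
apply: cvg_trans; apply: near_eq_cvg.
by have [[M BM] _] := dB; exists M => // t F _ JF; rewrite uv.
Qed.

Let blim_cst B c : directed B -> blim B (dcst c) c.
Proof.
move=> dB; have BF := bfilter_filter dB; apply/blimP => //.
apply: (bcongr (u := fun=> c)) => //; last exact: cvg_cst.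
by move=> t F JF /=; rewrite glim_cst.
Qed.

Let blimD B f g c d : directed B ->
  blim B f c -> blim B g d -> blim B (f + g) (c + d).
Proof.
move=> dB; have BF := bfilter_filter dB.
rewrite !blimP// => fc gd; apply: bcongr (cvgD fc gd) => // t F JF.
by symmetry; exact: (glimD (f t) (g t)).
Qed.

Let blimM B f g c d : directed B ->
  blim B f c -> blim B g d -> blim B (f * g) (c * d).
Proof.
move=> dB; have BF := bfilter_filter dB.
rewrite !blimP// => fc gd; apply: bcongr (cvgM fc gd) => // t F JF.
by symmetry; exact: (glimM (f t) (g t)).
Qed.

Let lty_l e e' : (e < e')%E -> (e < +oo)%E.
Proof. by move=> /lt_le_trans; apply; exact: leey. Qed.
Let lty_r e e' : (e' < e)%E -> (-oo < e)%E.
Proof. by apply: le_lt_trans; exact: leNye. Qed.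

Lemma in_dG_cst c : in_dG (dcst c : dyn).
Proof.
split=> e /andP[ae eb]; exists c; [apply/blim_r|apply/blim_l]; apply: blim_cst.
- exact: rbase_directed (lty_l eb).
- exact: lbase_directed (lty_r ae).
Qed.

Lemma in_dGD f g : in_dG f -> in_dG g -> in_dG (f + g).
Proof.
move=> [fr fl] [gr gl]; split=> e aeb; have /andP[ae eb] := aeb.
- have [c fc] := fr _ aeb; have [d gd] := gr _ aeb; exists (c + d).
  by apply/blim_r; apply: blimD;
    [exact: rbase_directed (lty_l eb)|exact/blim_r|exact/blim_r].
- have [c fc] := fl _ aeb; have [d gd] := gl _ aeb; exists (c + d).
  by apply/blim_l; apply: blimD;
    [exact: lbase_directed (lty_r ae)|exact/blim_l|exact/blim_l].
Qed.

Lemma in_dGM f g : in_dG f -> in_dG g -> in_dG (f * g).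
Proof.
move=> [fr fl] [gr gl]; split=> e aeb; have /andP[ae eb] := aeb.
- have [c fc] := fr _ aeb; have [d gd] := gr _ aeb; exists (c * d).
  by apply/blim_r; apply: blimM;
    [exact: rbase_directed (lty_l eb)|exact/blim_r|exact/blim_r].
- have [c fc] := fl _ aeb; have [d gd] := gl _ aeb; exists (c * d).
  by apply/blim_l; apply: blimM;
    [exact: lbase_directed (lty_r ae)|exact/blim_l|exact/blim_l].
Qed.

Lemma dyn_scaleE c f : c *: f = dcst c * f.
Proof. by []. Qed.

Lemma in_dGZ c f : in_dG f -> in_dG (c *: f).
Proof.
by move=> fG; rewrite dyn_scaleE; apply: in_dGM => //; exact: in_dG_cst.
Qed.

Lemma in_dGN f : in_dG f -> in_dG (- f).
Proof. by move=> fG; rewrite -scaleN1r; exact: in_dGZ. Qed.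

Let dG_subring : subring_closed (@dG_pred R a b).
Proof.
split.
- by apply/asboolP; exact: in_dG_cst.
- move=> f g /asboolP fG /asboolP gG.
  by apply/asboolP/in_dGD => //; exact: in_dGN.
- by move=> f g /asboolP fG /asboolP gG; apply/asboolP/in_dGM.
Qed.

HB.instance Definition _ := GRing.isSubringClosed.Build dyn
  (@dG_pred R a b) dG_subring.

Let dG_scale : scaler_closed (@dG_pred R a b).
Proof. by move=> c f /asboolP fG; apply/asboolP/in_dGZ. Qed.

HB.instance Definition _ := GRing.isScaleClosed.Build R dyn
  (@dG_pred R a b) dG_scale.

End DynamicTheory.

Record dG (R : realType) (a b : \bar R) : Type := DG {
  dG_val :> dyn a b ;
  dG_valP : dG_val \in dG_pred }.

Section dGInstances.
Context (R : realType) (a b : \bar R).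
HB.instance Definition _ := [isSub for @dG_val R a b].
HB.instance Definition _ := [Choice of dG a b by <:].
HB.instance Definition _ := GRing.SubChoice_isSubComPzRing.Build
  (dyn a b) (@dG_pred R a b) (dG a b) (subringClosedP _).
HB.instance Definition _ := [SubZmodule_isSubLmodule of dG a b by <:].
End dGInstances.

Section Spaces.
Context {R : realType} {a b : \bar R}.
Notation I := (oitv a b).
Implicit Types (f g : dG a b).

Definition dnorm f : \bar R := dsup [set: I] f.

Definition dG_cvg (f_ : nat -> dG a b) f : Prop :=
  (fun n => dnorm (f_ n - f)) @ \oo --> 0%E.

(* The closure is taken in the subspace I.                                   *)
Definition supp f : set I := closure [set t : I |
  ~ (exists c, f t = gcst c) \/ (exists2 c, f t = gcst c & c <> 0)].

Definition test_pred : {pred dG a b} := [pred f | `[< compact (supp f) >]].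

Lemma dGDE f g t : (f + g) t = f t + g t. Proof. by []. Qed.
Lemma dGBE f g t : (f - g) t = f t - g t. Proof. by []. Qed.
Lemma dGME f g t : (f * g) t = f t * g t. Proof. by []. Qed.
Lemma dGZE c f t : (c *: f) t = c *: f t. Proof. by []. Qed.

Lemma dGZAr c f g : f * (c *: g) = c *: (f * g).
Proof.
apply: val_inj; apply/funext => t; exact: (scalerAr_GJ c (f t) (g t)).
Qed.

Lemma suppE f : supp f = closure [set t : I | f t <> 0].
Proof.
congr closure; apply/seteqP; split => t /=.
  move=> [fc ft0|[c -> c0] /(congr1 (fun x => glim x 0^'+))].
    by apply: fc; exists 0.
  by rewrite glim_cst ?glim0//; exact: J_sides0.
move=> ft0; have [[c ftc]|] := pselect (exists c, f t = gcst c); last by left.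
by right; exists c => // c0; apply: ft0; rewrite ftc c0.
Qed.

Lemma closed_supp f : closed (supp f).
Proof. exact: closed_closure. Qed.

Lemma notin_supp f t : ~ supp f t -> f t = 0.
Proof.
rewrite suppE => ft; apply: contrapT => ft0; apply: ft.
exact: subset_closure.
Qed.

Lemma supp_sub f (A : set I) : closed A ->
  (forall t, ~ A t -> f t = 0) -> supp f `<=` A.
Proof.
move=> Acl fA; rewrite suppE closureE; apply: smallest_sub => // t ft0.
by apply: contrapT => /fA.
Qed.

Lemma suppM f g : supp (f * g) `<=` supp g.
Proof.
apply: supp_sub; first exact: closed_supp.
by move=> t /notin_supp gt0; rewrite dGME gt0 mulr0.
Qed.

Lemma supp_scaleD c f g : supp (c *: f + g) `<=` supp f `|` supp g.
Proof.
apply: supp_sub; first by apply: closedU; exact: closed_supp.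
move=> t /not_orP[/notin_supp ft0 /notin_supp gt0].
by rewrite dGDE dGZE ft0 gt0 scaler0 addr0.
Qed.

Lemma dG_cvgP (t0 : I) (f_ : nat -> dG a b) f : dG_cvg f_ f <->
  forall eps : R, 0 < eps -> \forall n \near \oo,
    forall t F, J_sides F -> `|glim (f_ n t) F - glim (f t) F| <= eps.
Proof.
split=> [H eps eps0|H].
  have Hn : \forall n \near \oo, (dnorm (f_ n - f)%R < eps%:E)%E.
    apply: (H (fun u : \bar R => (u < eps%:E)%E)).
    exact: (@open_ereal_lt' _ 0%E).
  apply: filterS Hn => n /= /ltW /dsup_le fn t F JF.
  by have := fn t Logic.I F JF; rewrite dGBE glimB// lee_fin.
have ge0 n : (0 <= dnorm (f_ n - f)%R)%E.
  apply: le_trans (gsup_ge0 ((f_ n - f)%R t0)) _.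
  by apply: ereal_sup_ubound; exists t0.
have le_eps eps : 0 < eps -> \forall n \near \oo,
    (dnorm (f_ n - f)%R <= eps%:E)%E.
  move=> /H Hn; apply: filterS Hn => n fn; apply/dsup_le => t _ F JF.
  by rewrite dGBE glimB// lee_fin; exact: fn.
apply/fine_cvgP; split.
  apply: filterS (le_eps 1 ltr01) => n fn1.
  by rewrite ge0_fin_numE// (le_lt_trans fn1)// ltry.
apply/cvgrPdist_le => /= eps /le_eps Hn; apply: filterS Hn => n.
have := ge0 n; case: (dnorm _) => //= r; rewrite !lee_fin => r0 reps.
by rewrite sub0r normrN ger0_norm.
Qed.

End Spaces.

Lemma ereal_creep (R : realType) (a b : \bar R) (Q : \bar R -> Prop) :
  (a <= b)%E -> Q a ->
  (forall e, (a <= e < b)%E -> Q e -> exists2 y, (e < y <= b)%E & Q y) ->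
  (forall e, (a < e <= b)%E -> exists2 y0, (y0 < e)%E &
     forall y, (y0 < y <= e)%E -> Q y -> Q e) ->
  Q b.
Proof.
move=> ab Qa Qr Ql; pose S := [set e | (a <= e <= b)%E /\ Q e].
have Sa : S a by split=> //; rewrite lexx.
have as_ : (a <= ereal_sup S)%E by exact: ereal_sup_ubound.
have sb : (ereal_sup S <= b)%E by apply: ge_ereal_sup => e [/andP[_ eb] _].
have Qs : Q (ereal_sup S).
  move: as_; rewrite le_eqVlt => /predU1P[<-//|as_].
  have [|y0 y0s Hy0] := Ql (ereal_sup S); first by rewrite as_.
  have [y Sy y0y] := ereal_sup_gt y0s.
  by apply: (Hy0 y) (proj2 Sy); rewrite y0y/=; exact: ereal_sup_ubound.
move: sb; rewrite le_eqVlt => /predU1P[<-//|sb].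
have [|y /andP[sy yb] Qy] := Qr _ _ Qs; first by rewrite as_.
have : (y <= ereal_sup S)%E.
  by apply: ereal_sup_ubound; split=> //; rewrite yb (le_trans as_ (ltW sy)).
by rewrite leNgt sy.
Qed.

Section Boundedness.
Context {R : realType}.

Let right_bounded (h : R -> R) (e : R) : cvg (h @ e^'+) ->
  exists2 d, 0 < d & exists K : R, forall t, e < t < e + d -> `|h t| <= K.
Proof.
move=> /cvgr_norm_ley[M [_ HM]].
have := HM (M + 1); rewrite ltrDl => /(_ ltr01) /nbhs_ballP[d /= d0 Hd].
exists d => //; exists (M + 1) => t /andP[et ted]; apply: Hd => //=.
by rewrite /ball/= ltr0_norm ?subr_lt0// opprB ltrBlDl.
Qed.

Let left_bounded (h : R -> R) (e : R) : cvg (h @ e^'-) ->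
  exists2 d, 0 < d & exists K : R, forall t, e - d < t < e -> `|h t| <= K.
Proof.
move=> /cvgr_norm_ley[M [_ HM]].
have := HM (M + 1); rewrite ltrDl => /(_ ltr01) /nbhs_ballP[d /= d0 Hd].
exists d => //; exists (M + 1) => t /andP[et ted]; apply: Hd => //=.
by rewrite /ball/= gtr0_norm ?subr_gt0// ltrBlDr -ltrBlDl.
Qed.

Lemma regulated_bounded (h : R -> R) : regulated h ->
  exists K : R, forall t, - 2^-1 < t < 2^-1 -> `|h t| <= K.
Proof.
move=> rh; pose Q (e : \bar R) := exists K : R, forall t : R,
  (- 2^-1 < t) -> (t%:E < e)%E -> `|h t| <= K.
suff [K HK] : Q (2^-1)%:E.
  by exists K => t /andP[t1 t2]; apply: HK; rewrite ?lte_fin.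
have h2 : 0 < 2^-1 :> R by rewrite invr_gt0.
apply: (@ereal_creep _ (- 2^-1)%:E).
- by rewrite lee_fin ge0_cp// ltW.
- exists 0 => t t1; rewrite lte_fin => t2.
  by have := lt_trans t1 t2; rewrite ltxx.
- case=> [e| |]; last 2 first.
  + by rewrite andbC ltNge leey.
  + by rewrite leNgt ltNyr.
  rewrite lee_fin lte_fin => /andP[e1 e2] [K HK].
  have [|d d0 [K' HK']] := @right_bounded h e.
    by apply: rh; left; exists e => //; rewrite e1.
  exists (Num.min (e + d) 2^-1)%:E.
    by rewrite lte_fin lee_fin lt_min ltrDl d0 e2 ge_min lexx orbT.
  exists (Num.max K (Num.max `|h e| K')) => t t1.
  rewrite lte_fin lt_min => /andP[td _].
  rewrite !le_max; have [te|et|->] := ltgtP t e.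
  + by rewrite HK// lte_fin.
  + by rewrite HK' ?orbT// et.
  + by rewrite lexx orbT.
- case=> [e| |]; last 2 first.
  + by rewrite andbC leNgt ltry.
  + by rewrite ltNge leNye.
  rewrite lee_fin lte_fin => /andP[e1 e2].
  have [|d d0 [K' HK']] := @left_bounded h e.
    by apply: rh; right; exists e => //; rewrite e1.
  exists (e - d)%:E; first by rewrite lte_fin gtrBl.
  move=> y /andP[dy ye] [K HK]; exists (Num.max K K') => t t1 te.
  rewrite le_max; have [ty|yt] := ltP t%:E y; first by rewrite HK.
  by rewrite HK' ?orbT// -!lte_fin te (lt_le_trans dy yt).
Qed.

Lemma gsup_lty (x : GJ R) : (gsup x < +oo)%E.
Proof.
have [K HK] := regulated_bounded (@regfunP R (repr x)).
apply: (@le_lt_trans _ _ K%:E); last exact: ltry.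
apply/gsup_le => F JF; have FF := J_sides_proper JF.
rewrite lee_fin; apply: (cvgr_to_le (cvg_norm (glim_cvg JF))).
have : F [set t : R | - 2^-1 < t < 2^-1].
  case: JF => -[s /andP[s1 s2] ->].
    near=> t; apply/andP; split; last by near: t; exact: nbhs_right_lt.
    by apply: (le_lt_trans s1); near: t; exact: nbhs_right_gt.
  near=> t; apply/andP; split; first by near: t; exact: nbhs_left_gt.
  by apply: (lt_le_trans _ s2); near: t; exact: nbhs_left_lt.
by apply: filterS => t; exact: HK.
Unshelve. all: by end_near. Qed.

Context {a b : \bar R}.
Notation I := (oitv a b).

Let dist_bounded (x : GJ R) c : (gsup (x - gcst c)%R <= 1)%E ->
  (gsup x <= (1 + `|c|)%:E)%E.
Proof.
move=> /gsup_le xc; apply/gsup_le => F JF; have := xc F JF.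
rewrite glimB// glim_cst// !lee_fin => xc1.
rewrite -[glim x F](subrK c); apply: le_trans (ler_normD _ _) _.
by rewrite lerD2r.
Qed.

Lemma dG_bounded (f : dG a b) : exists K : R,
  forall (t : I) F, J_sides F -> `|glim (f t) F| <= K.
Proof.
have /asboolP[fr fl] := dG_valP f.
pose Q (e : \bar R) := exists K : R, forall t : I,
  ((\val t)%:E < e)%E -> (gsup (f t) <= K%:E)%E.
have [ab|ba] := leP a b; last first.
  exists 0 => t; have /set_mem/= /andP[a_t tb] := valP t.
  by have := lt_trans (lt_trans a_t tb) ba; rewrite ltxx.
suff [K HK] : Q b.
  exists K => t F JF; have /set_mem/= /andP[_ tb] := valP t.
  by have /gsup_le/(_ F JF) := HK t tb; rewrite lee_fin.
apply: (@ereal_creep _ a) => //.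
- exists 0 => t ta; have /set_mem/= /andP[a_t _] := valP t.
  by have := lt_trans ta a_t; rewrite ltxx.
- move=> e aeb [K HK]; have /andP[ae eb] := aeb.
  have [c /(_ 1 ltr01)[y ey /ltW /dsup_le fc]] := fr e aeb.
  have [K0 HK0] : exists K0 : R, forall t : I, (\val t)%:E = e ->
      (gsup (f t) <= K0%:E)%E.
    have [[t te]|nt] := pselect (exists t : I, (\val t)%:E = e); last first.
      by exists 0 => t te; exfalso; apply: nt; exists t.
    exists (fine (gsup (f t))) => t'; rewrite -te => -[/val_inj ->].
    by rewrite fineK// ge0_fin_numE ?gsup_ge0// gsup_lty.
  exists (Order.min y%:E b); first by rewrite lt_min ey eb ge_min lexx orbT.
  exists (Num.max K (Num.max K0 (1 + `|c|))) => t.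
  rewrite lt_min => /andP[ty _].
  rewrite !EFin_max !le_max; have [te|et|te] := ltgtP (\val t)%:E e.
  + by rewrite HK.
  + rewrite (@dist_bounded _ c) ?orbT//; apply/gsup_le => F JF.
    by apply: (fc t) => //; rewrite /= et.
  + by rewrite HK0// orbT.
- move=> e aeb; have [c /(_ 1 ltr01)[y ye /ltW /dsup_le fc]] := fl e aeb.
  exists y%:E => // z /andP[yz ze] [K HK].
  exists (Num.max K (1 + `|c|)) => t te.
  rewrite EFin_max le_max; have [tz|zt] := ltP (\val t)%:E z.
    by rewrite HK.
  rewrite (@dist_bounded _ c) ?orbT//; apply/gsup_le => F JF.
  by apply: (fc t) => //; rewrite /= te (lt_le_trans yz zt).
Qed.

End Boundedness.

Section TestClosed.
Context {R : realType} {a b : \bar R}.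

Let test_submod : submod_closed (@test_pred R a b).
Proof.
split=> [|c f g /asboolP fK /asboolP gK]; apply/asboolP.
  have -> : supp (0 : dG a b) = set0; last exact: compact0.
  by apply/seteqP; split=> //; apply: supp_sub; first exact: closed0.
apply: subclosed_compact (@supp_scaleD _ _ _ c f g).
- exact: closed_supp.
- exact: compactU.
Qed.

HB.instance Definition _ :=
  GRing.isSubmodClosed.Build R (dG a b) (@test_pred R a b) test_submod.

End TestClosed.

Record test (R : realType) (a b : \bar R) : Type := Test {
  test_val :> dG a b ;
  test_valP : test_val \in test_pred }.

Section TestInstances.
Context (R : realType) (a b : \bar R).
HB.instance Definition _ := [isSub for @test_val R a b].
HB.instance Definition _ := [Choice of test a b by <:].
HB.instance Definition _ := [SubChoice_isSubZmodule of test a b by <:].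
HB.instance Definition _ := [SubZmodule_isSubLmodule of test a b by <:].
End TestInstances.

Section TestTheory.
Context {R : realType} {a b : \bar R}.
Notation I := (oitv a b).
Implicit Types (g : dG a b) (phi : test a b).

Definition test_cvg (phi_ : nat -> test a b) phi : Prop :=
  dG_cvg phi_ phi /\
  exists c d : I, forall n,
    supp (phi_ n) `<=` [set t : I | \val c <= \val t <= \val d].

Let test_mul_subproof g phi : (g * phi : dG a b) \in test_pred.
Proof.
apply/asboolP; have /asboolP := test_valP phi => phiK.
by apply: subclosed_compact phiK (@suppM _ _ _ _ _); exact: closed_supp.
Qed.

Definition test_mul g phi : test a b := Test (test_mul_subproof g phi).

Lemma test_mul_linear g : linear (test_mul g).
Proof.
by move=> c phi psi; apply: val_inj => /=; rewrite mulrDr dGZAr.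
Qed.

Lemma test_mul_cvg g (phi_ : nat -> test a b) phi :
  test_cvg phi_ phi -> test_cvg (fun n => test_mul g (phi_ n)) (test_mul g phi).
Proof.
move=> [phiG [c [d phicd]]]; split; last first.
  by exists c, d => n; apply: subset_trans (phicd n); exact: suppM.
have [K gK] := dG_bounded g.
move: phiG => /(dG_cvgP c) phiG; apply/(dG_cvgP c) => eps eps0.
have K1 : 0 < `|K| + 1 by rewrite ltr_pwDr.
have /phiG Hn : 0 < eps / (`|K| + 1) by rewrite divr_gt0.
apply: filterS Hn => n Hn t F JF.
rewrite !dGME !glimM// -mulrBr normrM.
rewrite -[eps](divfK (lt0r_neq0 K1)) mulrC ler_pM// ?Hn//.
by rewrite (le_trans (gK t F JF))// (le_trans (ler_norm K))// lerDl.
Qed.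

End TestTheory.

Record dist (R : realType) (a b : \bar R) : Type := Dist {
  dist_val :> {scalar test a b} ;
  dist_continuous : forall (phi_ : nat -> test a b) (phi : test a b),
    test_cvg phi_ phi -> (fun n => dist_val (phi_ n)) @ \oo --> dist_val phi }.

Section Distributions.
Context {R : realType} {a b : \bar R}.
Implicit Types (f : dist a b) (g : dG a b) (phi : test a b).

Definition dist_cvg (f_ : nat -> dist a b) f : Prop :=
  forall phi, (fun n => f_ n phi) @ \oo --> f phi.

Definition dist_mul_fun g f : test a b -> R := fun phi => f (test_mul g phi).

Let dist_mul_linear g f : scalar (dist_mul_fun g f).
Proof.
by move=> c phi psi; rewrite /dist_mul_fun test_mul_linear linearP.
Qed.

HB.instance Definition _ g f := GRing.isLinear.Build R (test a b) R _
  (dist_mul_fun g f) (dist_mul_linear g f).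

Let dist_mul_continuous g f (phi_ : nat -> test a b) phi :
  test_cvg phi_ phi ->
  (fun n => dist_mul_fun g f (phi_ n)) @ \oo --> dist_mul_fun g f phi.
Proof. by move=> /(test_mul_cvg g)/(@dist_continuous _ _ _ f). Qed.

Definition dist_mul g f : dist a b :=
  @Dist R a b (dist_mul_fun g f) (@dist_mul_continuous g f).

Lemma dist_mulE g f phi : dist_mul g f phi = f (test_mul g phi).
Proof. by []. Qed.

End Distributions.

(* Main.v *)
(* Fix a test function phi. The maps h |-> (f_n, h phi) are continuous linear   *)
(* functionals on dG, pointwise bounded since f_n converges. As dG is complete, *)
(* they are uniformly bounded on some ball, so (f_n, (g_n - g) phi) tends to 0, *)
(* while (f_n, g phi) tends to (f, g phi) by assumption.                        *)
From HB Require Import structures.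
Require Import Defs.
From mathcomp Require Import all_boot all_order all_algebra.
From mathcomp Require Import all_classical all_reals all_analysis.
From mathcomp Require Import lra generic_quotient.

Set Implicit Arguments.
Unset Strict Implicit.
Unset Printing Implicit Defensive.

Import Order.TTheory GRing.Theory Num.Theory.
Import numFieldNormedType.Exports.

Local Open Scope classical_set_scope.
Local Open Scope ring_scope.

(** Convergence of f_n on each test function gives no uniform control by itself, so the term (f_n,
    (g_n - g) phi) calls for a Banach-Steinhaus argument on dG. [dist_slice] turns f_n into the
    functional h |-> (f_n, h phi), continuous by [test_mul_cvgl], and [uniform_boundedness] bounds
    these functionals on a common ball. The completeness it needs, [dG_complete], has two layers:
    [GJ_complete] for each dynamic value, and [in_dG_approx], by which uniform limits keep their
    one-sided limits in t. Both layers rest on [approx_limit]. *)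

(** * Limits of real sequences and functions *)

Section Reals.
Context {R : realType}.

(* The upper and lower ends of the intervals [u k - r k, u k + r k] are       *)
(* monotone, so the supremum of the lower ends lies in all of them.          *)
Lemma nested_center (u r : R^nat) :
  (forall k, 0 <= r k) -> (forall k, `|u k.+1 - u k| <= r k - r k.+1) ->
  forall k, `|sup (range (u - r)) - u k| <= r k.
Proof.
move=> r0 ur.
have lo : nondecreasing_seq (u - r).
  by apply/nondecreasing_seqP => k; move: (ur k);
    rewrite !fctE ler_norml => /andP[]; lra.
have hi : nonincreasing_seq (u + r).
  by apply/nonincreasing_seqP => k; move: (ur k);
    rewrite !fctE ler_norml => /andP[]; lra.
have lohi k m : u m - r m <= u k + r k.
  have [/lo|/ltnW/hi] := leqP m k; have := r0 k; have := r0 m;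
  by rewrite !fctE; lra.
move=> k; rewrite ler_norml; apply/andP; split.
  suff : u k - r k <= sup (range (u - r)) by lra.
  apply: ub_le_sup; last by exists k.
  by exists (u 0%N + r 0%N) => _ [m _ <-]; exact: lohi.
suff : sup (range (u - r)) <= u k + r k by lra.
apply: ge_sup; first by exists (u 0%N - r 0%N), 0%N.
by move=> _ [m _ <-]; exact: lohi.
Qed.

(** Cauchy criterion along a family of pairwise meeting sets. The limit is the lower limit of [h],
    the supremum of the numbers that bound [h] from below on some member; as two members always
    meet, it stays within the error of any constant that fits [h] on a member. *)
Lemma approx_limit (T : Type) (B : set (set T)) (h : T -> R) :
  (forall M N, B M -> B N -> M `&` N !=set0) ->
  (forall eps, 0 < eps -> exists c, exists2 M, B M &
    forall x, M x -> `|h x - c| <= eps) ->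
  exists c, forall eps, 0 < eps -> exists2 M, B M &
    forall x, M x -> `|h x - c| <= eps.
Proof.
move=> BI hB; pose S := [set y | exists2 M, B M & forall x, M x -> y <= h x].
exists (sup S) => eps eps0.
have [|c [M BM hc]] := hB (eps / 2); first by rewrite divr_gt0.
have Sc : S (c - eps / 2).
  by exists M => // x /hc; rewrite ler_norml => /andP[]; lra.
have Sub : ubound S (c + eps / 2).
  move=> y [N BN yh]; have [x [/hc Mx /yh]] := BI _ _ BM BN.
  by move: Mx; rewrite ler_norml => /andP[]; lra.
have c_sup : c - eps / 2 <= sup S by apply: ub_le_sup => //;
  exists (c + eps / 2).
have sup_c : sup S <= c + eps / 2 by apply: ge_sup => //; exists (c - eps / 2).
exists M => // x /hc; rewrite !ler_norml => /andP[? ?]; apply/andP; split; lra.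
Qed.

End Reals.

(** * Completeness of G(J) *)

Section GJComplete.
Context {R : realType}.
Implicit Types (F : set_system R) (x : GJ R).

Lemma J_sides_interior F : J_sides F -> F [set s | - 2^-1 < s < 2^-1].
Proof.
case=> -[s /andP[s1 s2] ->].
- near=> t; apply/andP; split; last by near: t; exact: nbhs_right_lt.
  by apply: (le_lt_trans s1); near: t; exact: nbhs_right_gt.
- near=> t; apply/andP; split; first by near: t; exact: nbhs_left_gt.
  by apply: (lt_le_trans _ s2); near: t; exact: nbhs_left_lt.
Unshelve. all: by end_near. Qed.

(** A side of a point is its neighbourhood filter cut by an open half-line. Points of the half-line
    close to the base point have [P] as a full neighbourhood, hence also on their right. *)
Lemma J_sides_near_right F (P : set R) : J_sides F -> F P ->
  F [set s | s^'+ P].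
Proof.
have aux (s : R) (D : set R) : open D -> within D (nbhs s) P ->
    within D (nbhs s) [set s | s^'+ P].
  move=> Do /nbhs_interior; apply: filterS => t /= tP Dt.
  have : nbhs t P.
    by apply: filterS2 tP (open_nbhs_nbhs (conj Do Dt)) => y; apply.
  exact: (@cvg_within _ (nbhs t)).
by case=> -[s _ ->]; apply: aux; [exact: open_gt|exact: open_lt].
Qed.

(* The values of [repr x] at points are arbitrary; those of its right limits *)
(* are controlled by [x].                                                    *)
Lemma glim_right_cvg x F : J_sides F ->
  (fun s => glim x s^'+) @ F --> glim x F.
Proof.
move=> JF; have FF := J_sides_proper JF; apply/cvgrPdist_le => eps eps0.
have xF : F [set s | s^'+ [set t | `|glim x F - repr x t| <= eps]].
  apply: J_sides_near_right => //.
  by have /cvgrPdist_le := @glim_cvg _ x _ JF; apply.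
apply: filterS2 (J_sides_interior JF) xF => s /andP[s1 s2] xs.
have Js : J_sides s^'+ by left; exists s; rewrite // s2 ltW.
exact: cvgr_to_le (cvg_norm (cvgB (cvg_cst _) (@glim_cvg _ x _ Js))) xs.
Qed.

Lemma GJ_complete (x_ : nat -> GJ R) (r : R^nat) :
  (forall k, 0 <= r k) -> r @ \oo --> 0 ->
  (forall k F, J_sides F ->
    `|glim (x_ k.+1) F - glim (x_ k) F| <= r k - r k.+1) ->
  exists x, forall k F, J_sides F -> `|glim x F - glim (x_ k) F| <= r k.
Proof.
move=> r0 rcvg xr.
(* For s interior to J, the intervals of radius [r k] about the right limits at s are nested, by the
   bounds [r k - r k.+1]; [h s] is a point common to all of them. *)
pose h (s : R) := sup (range ((fun k => glim (x_ k) s^'+) - r)).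
have hx k F : J_sides F -> F [set s | `|h s - glim (x_ k) s^'+| <= r k].
  move=> JF; have FF := J_sides_proper JF.
  apply: filterS (J_sides_interior JF) => s /andP[s1 s2].
  apply: (@nested_center _ (fun k => glim (x_ k) s^'+) r) => // m.
  by apply: xr; left; exists s; rewrite // s2 ltW.
have rh : regulated h.
  move=> F JF; have FF := J_sides_proper JF.
  have [| |l hl] := @approx_limit R R F h.
  - by move=> M N FM FN; exact/(@filter_ex _ F)/filterI.
  - move=> eps eps0.
    have [k rk] : exists k, r k <= eps / 2.
      have /cvgrPdist_le/(_ (eps / 2)) := rcvg.
      rewrite divr_gt0// => /(_ isT)[k _ /(_ k (leqnn k))] /=.
      by rewrite sub0r normrN ger0_norm//; exists k.
    (* [h] is within [r k] of the right limits of [x_ k], and these tend to [glim (x_ k) F]: two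
       errors of [eps / 2]. *)
    exists (glim (x_ k) F), [set s | `|h s - glim (x_ k) F| <= eps] => //.
    have /cvgrPdist_le/(_ (eps / 2)) := @glim_right_cvg (x_ k) F JF.
    rewrite divr_gt0// => /(_ isT); apply: filterS2 (hx k F JF) => s /=.
    by rewrite !ler_norml => /andP[? ?] /andP[? ?]; apply/andP; split; lra.
  - apply/cvg_ex; exists l; apply/cvgrPdist_le => eps /hl[M FM hM].
    by apply: filterS FM => s /hM; rewrite distrC.
exists (\pi_(GJ R) (Regfun rh))%qT => k F JF; have FF := J_sides_proper JF.
rewrite glim_pi//=; apply: cvgr_to_le (hx k F JF).
by apply: cvg_norm; apply: cvgB (@glim_right_cvg (x_ k) F JF); exact: rh.
Qed.

End GJComplete.

(** * Completeness of dG *)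

Lemma lte_between (R : realType) (x y : \bar R) :
  (x < y)%E -> exists r : R, (x < r%:E < y)%E.
Proof.
case: x y => [x| |] [y| |] //.
- by rewrite lte_fin => xy; exists ((x + y) / 2); rewrite !lte_fin; lra.
- by move=> _; exists (x + 1); rewrite lte_fin ltry andbT; lra.
- by move=> _; exists (y - 1); rewrite lte_fin ltNyr/=; lra.
- by move=> _; exists 0; rewrite ltNyr ltry.
Qed.

Section dGComplete.
Context {R : realType} {a b : \bar R}.
Notation I := (oitv a b).
Implicit Types (h u : dG a b) (r c : R).

Lemma dnorm_le h r : (dnorm h <= r%:E)%E <->
  forall t F, J_sides F -> `|glim (h t) F| <= r.
Proof.
split=> [/dsup_le hr t F JF|hr]; first by rewrite -lee_fin; exact: hr.
by apply/dsup_le => t _ F JF; rewrite lee_fin; exact: hr.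
Qed.

Lemma dnormB_le h u r : (dnorm (h - u)%R <= r%:E)%E <->
  forall t F, J_sides F -> `|glim (h t) F - glim (u t) F| <= r.
Proof.
by split=> [/dnorm_le hr t F JF|hr]; [|apply/dnorm_le => t F JF];
  have := hr t F JF; rewrite dGBE glimB.
Qed.

Lemma dsup_dcst_le (M : set I) (f : dyn a b) c r :
  (dsup M (f - Defs.dcst c)%R <= r%:E)%E <->
  forall t F, M t -> J_sides F -> `|glim (f t) F - c| <= r.
Proof.
have E t F : J_sides F -> glim ((f - Defs.dcst c)%R t) F = glim (f t) F - c.
  by move=> JF; rewrite [(f - Defs.dcst c)%R t]/(f t - gcst c) glimB// glim_cst.
split=> [/dsup_le fr t F Mt JF|fr].
  by rewrite -E// -lee_fin; exact: fr.
by apply/dsup_le => t Mt F JF; rewrite E// lee_fin; exact: fr.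
Qed.

(** A uniform limit inherits one-sided limits. The sets [M y] stand for the right or the left
    neighbourhoods of a point, so both sides are treated at once; [f] is read as a real function of
    the pair (t, F), to which [approx_limit] applies. *)
Lemma side_limit_approx (V : set R) (M : R -> set I) (f : dyn a b) :
  (forall y z, V y -> V z -> M y `&` M z !=set0) ->
  (forall eps, 0 < eps -> exists2 u : dyn a b,
    exists c, forall eps', 0 < eps' -> exists2 y, V y &
      (dsup (M y) (u - Defs.dcst c)%R < eps'%:E)%E &
    forall t F, J_sides F -> `|glim (f t) F - glim (u t) F| <= eps) ->
  exists c, forall eps, 0 < eps -> exists2 y, V y &
    (dsup (M y) (f - Defs.dcst c)%R < eps%:E)%E.
Proof.
move=> VI fu; pose B y := [set p : I * set_system R | M y p.1 /\ J_sides p.2].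
have [| |c fc] := @approx_limit R _ [set B y | y in V]
    (fun p => glim (f p.1) p.2).
- move=> _ _ [y Vy <-] [z Vz <-]; have [t [My Mz]] := VI _ _ Vy Vz.
  by exists (t, 0^'+); split; split=> //=; exact: J_sides0.
- move=> eps eps0; have eps20 : 0 < eps / 2 by rewrite divr_gt0.
  have [u [c uc] fu2] := fu _ eps20; exists c.
  have [y Vy /ltW/dsup_dcst_le uy] := uc _ eps20.
  exists (B y); first by exists y.
  move=> [t F] [/= My JF]; have := fu2 t F JF; have := uy t F My JF.
  by rewrite !ler_norml => /andP[? ?] /andP[? ?]; apply/andP; split; lra.
- exists c => eps eps0; have [|_ [y Vy <-] fy] := fc (eps / 2).
    by rewrite divr_gt0.
  exists y => //; apply: (@le_lt_trans _ _ (eps / 2)%:E); last first.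
    by rewrite lte_fin; lra.
  by apply/dsup_dcst_le => t F My JF; exact: (fy (t, F)).
Qed.

Lemma in_dG_approx (f : dyn a b) :
  (forall eps, 0 < eps -> exists u : dG a b,
    forall t F, J_sides F -> `|glim (f t) F - glim (u t) F| <= eps) ->
  in_dG f.
Proof.
move=> fu; split=> e aeb; have /andP[ae eb] := aeb.
- apply: (side_limit_approx (V := [set y | (e < y%:E)%E])
    (M := fun y => [set t : I | (e < (\val t)%:E < y%:E)%E])).
    move=> y z /= ey ez.
    (* Two right neighbourhoods of [e] meet inside I because a real fits between [e] and the least
       of [b], [y], [z]. *)
    have : (e < Order.min b (Num.min y z)%:E)%E.
      by rewrite lt_min eb EFin_min lt_min ey.
    move=> /lte_between[r]; rewrite lt_min EFin_min lt_min.
    move=> /andP[er /and3P[rb ry rz]].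
    have Ir : r \in I by rewrite inE /oitv/= (le_lt_trans ae er).
    by exists (SigSub Ir); rewrite /= er ry rz.
  move=> eps /fu[u fu']; exists u => //.
  by have /asboolP[ur _] := dG_valP u; exact: ur.
- apply: (side_limit_approx (V := [set y | (y%:E < e)%E])
    (M := fun y => [set t : I | (y%:E < (\val t)%:E < e)%E])).
    move=> y z /= ey ez.
    have : (Order.max a (Num.max y z)%:E < e)%E.
      by rewrite gt_max ae EFin_max gt_max ey.
    move=> /lte_between[r]; rewrite gt_max EFin_max gt_max.
    move=> /andP[/and3P[ra ry rz] er].
    have Ir : r \in I by rewrite inE /oitv/= ra (lt_le_trans er eb).
    by exists (SigSub Ir); rewrite /= er ry rz.
  move=> eps /fu[u fu']; exists u => //.
  by have /asboolP[_ ul] := dG_valP u; exact: ul.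
Qed.

Lemma dG_complete (u : nat -> dG a b) (r : R^nat) :
  (forall k, 0 <= r k) -> r @ \oo --> 0 ->
  (forall k, (dnorm (u k.+1 - u k)%R <= (r k - r k.+1)%:E)%E) ->
  exists f : dG a b, forall k, (dnorm (f - u k)%R <= (r k)%:E)%E.
Proof.
move=> r0 rcvg ur.
(* Limits are taken separately at each t; the bound [r k] is independent of t, so the convergence is
   uniform. *)
have /choice[f fu] t : exists x : GJ R, forall k F, J_sides F ->
    `|glim x F - glim (u k t) F| <= r k.
  by apply: GJ_complete => // k F JF; have /dnormB_le := ur k; exact.
have fG : (f : dyn a b) \in dG_pred.
  apply/asboolP/in_dG_approx => eps eps0.
  have /cvgrPdist_le/(_ eps eps0)[k _ /(_ k (leqnn k))] := rcvg.
  rewrite /= sub0r normrN ger0_norm// => rk; exists (u k) => t F JF.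
  exact: le_trans (fu t k F JF) rk.
by exists (DG fG) => k; apply/dnormB_le => t F; exact: fu.
Qed.

End dGComplete.

(** * Uniform boundedness on dG *)

Section UniformBoundedness.
Context {R : realType} {a b : \bar R}.
Notation I := (oitv a b).
Implicit Types (h u : dG a b) (r : R) (F : {scalar dG a b}).

Definition dG_continuous F : Prop := forall (h_ : nat -> dG a b) h,
  dG_cvg h_ h -> (fun k => F (h_ k)) @ \oo --> F h.

(** Otherwise some [h_ k] of norm at most 1 / (k + 1) has [1 < |F (h_ k)|], against sequential
    continuity at 0. *)
Lemma bounded_near0 (t0 : I) F : dG_continuous F ->
  exists2 r, 0 < r & forall h, (dnorm h <= r%:E)%E -> `|F h| <= 1.
Proof.
move=> Fcont; apply: contrapT => Fnb.
have /choice[h_ h_P] k : exists h,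
    (dnorm h <= (k.+1%:R^-1)%:E)%E /\ 1 < `|F h|.
  apply: contrapT => nh; apply: Fnb; exists k.+1%:R^-1 => // h hk.
  by rewrite leNgt; apply/negP => Fh; apply: nh; exists h.
have h0 : dG_cvg h_ 0.
  apply/(dG_cvgP t0) => eps eps0.
  have /cvgrPdist_le/(_ eps eps0) := @cvg_harmonic R.
  apply: filterS => k; rewrite /= sub0r normrN ger0_norm// => keps t G JG.
  have /dnorm_le/(_ t G JG)/le_trans := (h_P k).1.
  by rewrite [X in _ - X](glim0 JG) subr0; exact.
have /cvgrPdist_lt/(_ 1 ltr01)[k _ /(_ k (leqnn k))] := Fcont _ _ h0.
by rewrite /= raddf0 sub0r normrN ltNge (ltW (h_P k).2).
Qed.

(* If the family is unbounded on every ball, there are shrinking nested balls *)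
(* such that on the [k]-th one some [F n] has absolute value at least [k]; by  *)
(* completeness they have a common point, where the family is unbounded.      *)
Lemma uniform_boundedness (t0 : I) (F : nat -> {scalar dG a b}) :
  (forall n, dG_continuous (F n)) ->
  (forall h, exists K, forall n, `|F n h| <= K) ->
  exists2 r, 0 < r &
    exists K, forall n h, (dnorm h <= r%:E)%E -> `|F n h| <= K.
Proof.
move=> Fcont Fpw; apply: contrapT => Fnb.
(* [p] holds centre, radius and index. The premise on the radius sits inside the existential so that
   [choice] yields a total function, with default 0 where the premise fails. *)
have step (p : (dG a b * R) * nat) : exists s : dG a b * R, 0 < p.1.2 ->
    [/\ 0 < s.2 <= p.1.2 / 2, (dnorm (s.1 - p.1.1)%R <= (p.1.2 / 2)%:E)%E &
      exists n, forall h, (dnorm (h - s.1)%R <= s.2%:E)%E ->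
        p.2%:R <= `|F n h|].
  case: p => [[x r] k] /=.
  have [r0|_] := ltP 0 r; last by exists 0.
  have [K FK] := Fpw x.
  (* A value beyond [k + 1 + K] at [h] absorbs the bound [K] at the old centre [x] and a variation
     of at most 1 near the new centre [x + h]; at least [k] is left. *)
  have [n [h hr Fh]] : exists n, exists2 h,
      (dnorm h <= (r / 2)%:E)%E & k%:R + 1 + K < `|F n h|.
    apply: contrapT => nh; apply: Fnb; exists (r / 2);
      first by rewrite divr_gt0.
    exists (k%:R + 1 + K) => n h hr; rewrite leNgt; apply/negP => Fh.
    by apply: nh; exists n, h.
  have [d d0 Fd] := bounded_near0 t0 (Fcont n).
  exists (x + h, Num.min d (r / 2)) => _ /=; split.
  - by rewrite lt_min d0 divr_gt0//= ge_min lexx orbT.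
  - by rewrite addrC addKr.
  - exists n => f fd.
    have /Fd : (dnorm (f - (x + h))%R <= d%:E)%E.
      by apply: le_trans fd _; rewrite lee_fin ge_min lexx.
    rewrite !raddfB/= !raddfD/=; move: Fh (FK n) (ler_norm (F n f)).
    move: (lerNnormlW (lexx `|F n f|)).
    by case: (lerP 0 (F n h)) => [/ger0_norm->|/ltr0_norm->];
      rewrite !ler_norml => ? ? /andP[? ?] ? /andP[? ?]; lra.
have {step}[next nextP] := choice step.
pose s k := iteri k (fun i p => next (p, i)) (0, 1).
have s0 k : 0 < (s k).2.
  by elim: k => [|k IH]//=; have [/andP[]] := nextP (s k, k) IH.
have s_le k : (s k).2 <= 2^-1 ^+ k.
  elim: k => [|k IH]//=; have [/andP[_ /le_trans]] := nextP (s k, k) (s0 k).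
  by move=> + _ _; apply; rewrite exprSr ler_pM2r.
have [| |k|f fs] := @dG_complete _ _ _ (fun k => (s k).1) (fun k => (s k).2).
- by move=> k; exact: ltW.
- apply: (@squeeze_cvgr _ _ _ _ (cst 0) (fun k => 2^-1 ^+ k)).
  + by near=> k; rewrite /= s_le ltW.
  + exact: cvg_cst.
  + by apply: cvg_expr; rewrite ger0_norm// invf_lt1// ltr1n.
(* The radius at least halves at each step, so the bound of half the radius on the move of the
   centre is at most the difference of the two radii. *)
- have [/andP[_ sk] /le_trans + _] := nextP (s k, k) (s0 k).
  by apply; rewrite lee_fin /= in sk *; lra.
have [K FK] := Fpw f.
have K0 : 0 <= K by rewrite (le_trans _ (FK 0%N)).
(* Step k produces ball k + 1, on which some functional is at least k in absolute value; k is chosen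
   above [K]. *)
have [_ _ [n /(_ f (fs (Num.bound K).+1))]] :=
  nextP (s (Num.bound K), Num.bound K) (s0 _).
by rewrite leNgt (le_lt_trans (FK n))//= archi_boundP.
Unshelve. all: by end_near. Qed.

End UniformBoundedness.

(** * Distributions as functionals of the multiplier *)

Section Main.
Context {R : realType} {a b : \bar R}.
Notation I := (oitv a b).
Implicit Types (h : dG a b) (phi : test a b) (f : dist a b).

(** The endpoints required by [test_cvg] are the least and greatest points of the compact support;
    [t0] serves when the support is empty. *)
Lemma supp_test_bounded (t0 : I) phi : exists c d : I,
  supp phi `<=` [set t | \val c <= \val t <= \val d].
Proof.
have /asboolP phiK := test_valP phi.
have [[t phit]|nt] := pselect (supp phi !=set0); last first.
  by exists t0, t0 => t phit; exfalso; apply: nt; exists t.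
have val_cont : {within supp phi, continuous (\val : I -> R)}.
  by apply: continuous_subspaceT; exact: initial_continuous.
have phi0 : supp phi !=set0 by exists t.
have [c _ cP] := compact_EVT_min phi0 phiK val_cont.
have [d _ dP] := compact_EVT_max phi0 phiK val_cont.
by exists c, d => u /mem_set phiu; rewrite /= cP// dP.
Qed.

(** [phi] is bounded, and all the products are supported in [supp phi]. *)
Lemma test_mul_cvgl (t0 : I) (h_ : nat -> dG a b) h phi : dG_cvg h_ h ->
  test_cvg (fun n => test_mul (h_ n) phi) (test_mul h phi).
Proof.
move=> hh; split; last first.
  have [c [d phicd]] := supp_test_bounded t0 phi.
  by exists c, d => n; apply: subset_trans phicd; exact: suppM.
have [K phiK] := dG_bounded phi.
move: hh => /(dG_cvgP t0) hh; apply/(dG_cvgP t0) => eps eps0.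
have K1 : 0 < `|K| + 1 by rewrite ltr_pwDr.
have /hh : 0 < eps / (`|K| + 1) by rewrite divr_gt0.
apply: filterS => n hn t F JF.
rewrite !dGME !glimM// -mulrBl normrM.
rewrite -[eps](divfK (lt0r_neq0 K1)) ler_pM// ?hn//.
by rewrite (le_trans (phiK t F JF))// (le_trans (ler_norm K))// lerDl.
Qed.

Definition dist_slice phi f : dG a b -> R := fun h => f (test_mul h phi).

Let dist_slice_linear phi f : scalar (dist_slice phi f).
Proof.
move=> c g h; rewrite /dist_slice -linearP; congr (f _).
by apply: val_inj => /=; rewrite mulrDl [c *: g * _]mulrC dGZAr [_ * g]mulrC.
Qed.

HB.instance Definition _ phi f := GRing.isLinear.Build R (dG a b) R _
  (dist_slice phi f) (dist_slice_linear phi f).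

End Main.

Theorem theorem4 (R : realType) (a b : \bar R) (ab : (a < b)%E)
    (f_ : nat -> dist a b) (f : dist a b)
    (g_ : nat -> dG a b) (g : dG a b) :
  dist_cvg f_ f -> dG_cvg g_ g ->
  dist_cvg (fun n => dist_mul (g_ n) (f_ n)) (dist_mul g f).
Proof.
move=> ff gg phi.
have [t0 It0] := lte_between ab.
have It : t0 \in oitv a b by rewrite inE.
pose t1 : oitv a b := SigSub It.
have Fcont n : dG_continuous (dist_slice phi (f_ n)).
  move=> h_ h /(test_mul_cvgl t1 phi) hh.
  exact: (@dist_continuous _ _ _ (f_ n) _ _ hh).
have Fpw h : exists K, forall n, `|dist_slice phi (f_ n) h| <= K.
  have /cvgP/cvg_seq_bounded[K [_ HK]] := ff (test_mul h phi).
  by exists (K + 1) => n; apply: HK; rewrite ?ltrDl.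
have [r r0 [K FK]] := uniform_boundedness t1 Fcont Fpw.
have -> : (fun n => dist_mul (g_ n) (f_ n) phi) = (fun n =>
    dist_slice phi (f_ n) (g_ n - g) + dist_slice phi (f_ n) g).
  by apply/funext => n; rewrite -raddfD subrK.
rewrite -[dist_mul g f phi]add0r; apply: cvgD; last exact: ff.
(* Once [g_ n] is within [r / c] of [g], the difference scaled by [c] lies in the ball of radius
   [r]; dividing the bound [K] by [c] then leaves at most [eps]. *)
apply/cvgrPdist_le => eps eps0; pose c := (`|K| + 1) / eps.
have c0 : 0 < c by rewrite divr_gt0// ltr_pwDr.
have /(dG_cvgP t1)/(_ (r / c)) := gg; rewrite divr_gt0// => /(_ isT).
apply: filterS => n gn; rewrite sub0r normrN.
have /(FK n) : (dnorm (c *: (g_ n - g))%R <= r%:E)%E.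
  apply/dnorm_le => t F JF.
  rewrite dGZE glimZ// dGBE glimB// normrM gtr0_norm//.
  by rewrite -ler_pdivlMl// mulrC gn.
rewrite linearZ/= normrM gtr0_norm// -ler_pdivlMl// => /le_trans; apply.
rewrite /c invf_div mulrAC ler_pdivrMr ?ltr_pwDr// ler_pM2l//.
by rewrite (le_trans (ler_norm K))// lerDl.
Qed.
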